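(* Let $d\ge 2$, let $K$ be a function field of characteristic not dividing $d$, and let $f(z)=z^d+c\in K[z]$. Then $f$ is eventually stable over $K$ unless $c$ belongs to the field of constants of $K$; that is, if $c$ does not belong to the field of constants of $K$, then $f$ is eventually stable over $K$.
   Context: Here a function field means a finite extension $K$ of $F(t)$, where $F$ is any field; its field of constants is the algebraic closure of $F$ in $K$. $f^n$ denotes the $n$th iterate of $f$. A polynomial $f\in K[z]$ is eventually stable over $K$ if there is an $N\ge 0$ and a fixed $t$, depending only on $f$, such that for all $n>N$, $f^n$ is a product of exactly $t$ irreducible factors in $K[z]$. *)

(* Defs.v *)
From HB Require Import structures.
From mathcomp Require Import all_boot all_order all_algebra all_field.

Set Implicit Arguments.
Unset Strict Implicit.
Unset Printing Implicit Defensive.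

Import GRing.Theory.

Local Open Scope ring_scope.

(* A function field over [F] is a [K : fieldExtType (ratfun F)]; such extensions
   are finite by definition. *)
Notation ratfun F := {fraction {poly F}}.

Definition const_embed (F : fieldType) (K : fieldExtType (ratfun F)) (a : F) : K :=
  (tofrac a%:P)%:A.

Definition in_field_of_constants (F : fieldType) (K : fieldExtType (ratfun F))
    (c : K) : Prop :=
  algebraicOver (@const_embed F K) c.

Definition poly_iter (R : nzRingType) (f : {poly R}) (n : nat) : {poly R} :=
  iter n (fun g => f \Po g) 'X.

(* Factors are counted with multiplicity. *)
Definition product_of_irreducibles (K : fieldType) (t : nat) (p : {poly K}) : Prop :=
  exists s : t.-tuple {poly K},
    (forall i, irreducible_poly (tnth s i)) /\ p = \prod_(i < t) tnth s i.

Definition eventually_stable (K : fieldType) (f : {poly K}) : Prop :=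
  exists N t : nat,
    forall n : nat, (N < n)%N -> product_of_irreducibles t (poly_iter f n).

(* Main.v *)
Require Import Defs.
From HB Require Import structures.
From mathcomp Require Import all_boot all_order all_algebra all_field zify.
From Stdlib Require Import Classical.

Set Implicit Arguments.
Unset Strict Implicit.
Unset Printing Implicit Defensive.

Import GRing.Theory.
Local Open Scope ring_scope.

(** Write f = 'X^d + c. An element c of K outside the field of constants is
    transcendental over F, so the substitution X |-> c embeds A = F[X] into K,
    and f^n is the image of the n-th iterate P_n of z^d + X in A[z]. Two facts
    about this embedding bound the number of irreducible factors of f^n.

    - For n > 0, P_n is an Eisenstein polynomial at the prime X: it is monic,
      reduces to z^(d^n) at X = 0, and its constant term is divisible by X exactly once.
      Hence it is irreducible over F(X), of degree d^n
      ([eisenstein_pseudo], [reduce0_unicritical_iter],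
      [coef1_unicritical_iter0]).
    - K is finite over F(c). Indeed c is algebraic over F(t), and a polynomial
      relation between t and c over F shows conversely that t is algebraic
      over F(c) ([indeterminate_algebraic], [dependent_function_field]).

    Let M play the role of the degree of K over F(c), and let g be a factor of
    f^n over K of degree k > 0. The space K[z]/(g) has dimension at most M * k
    over F(c), whereas 1, z, ..., z^(d^n - 1) are independent in it over F(c)
    because P_n is irreducible. So d^n <= M * k ([eisenstein_factor_degree]),
    and since the degrees of the factors add up to d^n, there are at most M of
    them.

    Finally, composing with f sends a product of t irreducible polynomials to a
    product of at least t of them ([irreducible_prod_comp]). A bounded number
    of factors that cannot decrease is eventually constant
    ([bounded_nondecreasing_stable]).

    Linear algebra over F(c) is carried out with coefficients in A, clearing
    denominators where needed; this avoids extending the embedding of A to its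
    fraction field and giving K a second vector space structure. *)

(** * Linear dependence over an integral domain *)

(** For injective [psi] this is dependence over the fraction field of [A], since
    the denominators of a relation can be cleared. *)
Definition lin_dependent (A : idomainType) (K : fieldType) (psi : A -> K)
    (I : finType) (N : nat) (x : 'I_N -> I -> K) : Prop :=
  exists u : 'I_N -> A, (exists i, u i != 0) /\
    forall l, \sum_i psi (u i) * x i l = 0.

(** Denominators can be cleared simultaneously for a finite family as soon as
    the admissible denominators of each member are stable under multiples: take
    a product of individual ones. *)
Lemma common_multiplier (A : idomainType) (I : finType) (P : I -> A -> Prop) :
    (forall i a b, P i a -> P i (b * a)) ->
    (forall i, exists2 a, a != 0 & P i a) ->
  exists2 a, a != 0 & forall i, P i a.
Proof.
move=> PM exP.
have [a a0 Pa]: exists2 a, a != 0 & forall i, i \in enum I -> P i a.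
  elim: (enum I) => [|i s [a a0 Pa]]; first by exists 1; rewrite ?oner_neq0.
  have [b b0 Pb] := exP i; exists (a * b); first by rewrite mulf_neq0.
  move=> k; rewrite inE => /predU1P[-> | /Pa]; first exact: PM.
  by rewrite mulrC; apply: PM.
by exists a => // i; apply: Pa; rewrite mem_enum.
Qed.

Lemma frac_clear_denominator (A : idomainType) (x : {fraction A}) :
  exists2 b : A, b != 0 & exists n : A, tofrac b * x = tofrac n.
Proof.
elim/quotW: x => y; exists (frac y).2; first exact: denom_ratioP.
exists (frac y).1; rewrite /GRing.mul /= !piE; apply/eqmodP.
rewrite /= FracField.equivfE /FracField.mulf.
by rewrite !numden_Ratio ?mul1r ?mulr1 ?oner_neq0 ?denom_ratioP // mulrC.
Qed.

Lemma frac_common_denominator (A : idomainType) (I : finType)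
    (x : I -> {fraction A}) :
  exists2 b : A, b != 0 &
    exists n : I -> A, forall i, tofrac b * x i = tofrac (n i).
Proof.
have [i a b|i|b b0 bx] := @common_multiplier A I
    (fun i b => exists n : A, tofrac b * x i == tofrac n).
- by case=> n /eqP xn; exists (b * n); rewrite rmorphM -mulrA xn -rmorphM.
- have [b b0 [n xn]] := frac_clear_denominator (x i).
  by exists b => //; exists n; apply/eqP.
exists b => //; exists (fun i => xchoose (bx i)) => i.
by apply/eqP/(xchooseP (bx i)).
Qed.

Lemma dependent_domain (A : idomainType) (I : finType) (N : nat)
    (r : 'I_N -> I -> A) :
  (#|I| < N)%N ->
  exists u : 'I_N -> A, (exists i, u i != 0) /\ forall l, \sum_i u i * r i l = 0.
Proof.
move=> ltIN.
pose B : 'M[{fraction A}]_(N, #|I|) := \matrix_(i, j) tofrac (r i (enum_val j)).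
have kerB: kermx B != 0.
  rewrite -mxrank_eq0 mxrank_ker -lt0n subn_gt0.
  exact: leq_ltn_trans (rank_leq_col B) ltIN.
have /rowV0Pn[v /sub_kermxP vB v0] := kerB.
have [b b0 [u bv]] := frac_common_denominator (v 0).
exists u; split.
  have [i vi0]: exists i, v 0 i != 0 by apply/rV0Pn.
  by exists i; rewrite -tofrac_eq0 -bv mulf_neq0 // tofrac_eq0.
move=> l; apply/eqP; rewrite -tofrac_eq0 rmorph_sum /=.
have /rowP/(_ (enum_rank l)) := vB; rewrite !mxE => vl.
suff -> : \sum_i tofrac (u i * r i l) =
    tofrac b * \sum_i v 0 i * B i (enum_rank l).
  by rewrite vl mulr0.
rewrite mulr_sumr; apply: eq_bigr => i _.
by rewrite rmorphM /= -bv mxE enum_rankK mulrA.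
Qed.

(** Pseudo-division by [Q], after clearing the powers of its leading coefficient,
    puts every element of [A[tau]] in the span of the powers of [tau] below
    [size Q]. A family in [A[tau]]^I therefore has [#|I| * size Q] coordinates
    in [A], and more vectors than that are dependent. *)
Lemma dependent_adjoin (A : idomainType) (K : fieldType) (psi : {rmorphism A -> K})
    (tau : K) (Q : {poly A}) (I : finType) (N : nat) (v : 'I_N -> I -> {poly A}) :
    injective psi -> Q != 0 -> root (map_poly psi Q) tau ->
    (#|I| * size Q < N)%N ->
  lin_dependent psi (fun i l => (map_poly psi (v i l)).[tau]).
Proof.
move=> psi_inj Q0 /rootP Qtau ltN.
have [il a b|[i l]|a a0 av] := @common_multiplier A ('I_N * I)%type
    (fun il a => exists r : {poly A}, (size r <= size Q)%N &&
      (psi a * (map_poly psi (v il.1 il.2)).[tau] == (map_poly psi r).[tau])).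
- case=> r /andP[szr /eqP rv]; exists (b *: r).
  rewrite (leq_trans (size_scale_leq _ _)) //=.
  by rewrite map_polyZ hornerZ rmorphM -mulrA rv.
- exists (lead_coef Q ^+ scalp (v i l) Q).
    by rewrite expf_neq0 // lead_coef_eq0.
  exists (v i l %% Q); rewrite ltnW ?ltn_modp //=.
  rewrite -hornerZ -map_polyZ Pdiv.Idomain.divp_eq rmorphD rmorphM /=.
  by rewrite hornerD hornerM Qtau mulr0 add0r.
(* [a * v i l] evaluates at [tau] like the polynomial [r i l] of bounded size. *)
pose r i l := xchoose (av (i, l)).
have szr i l : (size (r i l) <= size Q)%N.
  by have /andP[] := xchooseP (av (i, l)).
have rv i l : psi a * (map_poly psi (v i l)).[tau] = (map_poly psi (r i l)).[tau].
  by have /andP[_ /eqP] := xchooseP (av (i, l)).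
have [|u [u0 ur]] := @dependent_domain A (I * 'I_(size Q))%type N
    (fun i lk => (r i lk.1)`_lk.2).
  by rewrite card_prod card_ord.
exists u; split=> // l.
have psia : psi a != 0 by rewrite -(rmorph0 psi) (inj_eq psi_inj).
apply: (mulfI psia); rewrite mulr0 mulr_sumr.
transitivity (\sum_i \sum_(k < size Q) psi (u i * (r i l)`_k) * tau ^+ k).
  apply: eq_bigr => i _; rewrite mulrCA rv.
  rewrite (@horner_coef_wide _ (size Q)) ?size_map_inj_poly ?rmorph0 //.
  by rewrite mulr_sumr; apply: eq_bigr => k _; rewrite coef_map rmorphM mulrA.
rewrite exchange_big /= big1 // => k _.
by rewrite -mulr_suml -rmorph_sum (ur (l, k)) rmorph0 mul0r.
Qed.

(** * Finiteness of a function field over F(c) *)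

Definition poly_embed (F : fieldType) (K : fieldExtType (ratfun F)) :
  {rmorphism {poly F} -> K} := GRing.in_alg K \o @FracField.tofrac {poly F}.

Definition const_morph (F : fieldType) (K : fieldExtType (ratfun F)) :
  {rmorphism F -> K} := @poly_embed F K \o polyC.

(** The map F[X] -> F[c] through which F(c) acts on [K]; it is defined for all
    [c], because F[t] is then also one of the F[c]. *)
Definition poly_at (F : fieldType) (K : fieldExtType (ratfun F)) (c : K) :
  {rmorphism {poly F} -> K} :=
  horner_morph (fun a : F => mulrC c (const_morph K a)).

Lemma poly_atE (F : fieldType) (K : fieldExtType (ratfun F)) (c : K) p :
  poly_at c p = (map_poly (const_morph K) p).[c].
Proof. by []. Qed.

Lemma poly_at_inj (F : fieldType) (K : fieldExtType (ratfun F)) (c : K) :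
  ~ in_field_of_constants c -> injective (poly_at c).
Proof.
move=> ctr; apply: raddf_inj => p pc.
apply/eqP/negPn/negP => p0; apply: ctr; exists p => //; exact/rootP.
Qed.

Lemma poly_embedE (F : fieldType) (K : fieldExtType (ratfun F)) p :
  poly_embed K p = poly_at (poly_embed K 'X) p.
Proof.
elim/poly_ind: p => [|p a IH]; first by rewrite !rmorph0.
rewrite [LHS]rmorphD [RHS]rmorphD.
rewrite [X in X + _]rmorphM [X in _ = X + _]rmorphM IH.
rewrite [poly_at _ 'X]poly_atE [poly_at _ a%:P]poly_atE.
by rewrite map_polyX map_polyC hornerX hornerC.
Qed.

(** Reading a polynomial in t as having constant coefficients in F[c] exhibits
    the image of F[t] inside F[c][t], to which [dependent_adjoin] applies. *)
Lemma poly_embed_constE (F : fieldType) (K : fieldExtType (ratfun F)) (c : K) p :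
  poly_embed K p =
  (map_poly (poly_at c) (map_poly polyC p)).[poly_embed K 'X].
Proof.
rewrite poly_embedE poly_atE -map_poly_comp; congr (_.[_]).
apply: eq_map_poly => a.
by rewrite [RHS]poly_atE map_polyC hornerC.
Qed.

Lemma horner_poly_at_swapXY (F : fieldType) (K : fieldExtType (ratfun F)) (x y : K)
    (u : {poly {poly F}}) :
  (map_poly (poly_at x) (swapXY u)).[y] = (map_poly (poly_at y) u).[x].
Proof.
have atE (z : K) w : map_poly (poly_at z) w =
    map_poly (horner_eval z) (map_poly (map_poly (const_morph K)) w).
  by rewrite -map_poly_comp.
by rewrite !atE -swapXY_map -!horner_swapXY swapXYK -horner2_swapXY.
Qed.

(** A polynomial relation between [c] and t over F can be read in either
    variable: the minimal equation of [c] over F(t), with denominators cleared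
    and variables swapped, is an equation of t over F[c]. *)
Lemma indeterminate_algebraic (F : fieldType) (K : fieldExtType (ratfun F)) (c : K) :
  exists2 Q : {poly {poly F}}, Q != 0 &
    root (map_poly (poly_at c) Q) (poly_embed K 'X).
Proof.
have /polyOver1P[P cP] := minPolyOver 1%AS c.
have P0: P != 0.
  apply: contraTneq (monic_neq0 (monic_minPoly 1%AS c)) => P0.
  by rewrite cP P0 rmorph0 eqxx.
have [b b0 [n bP]] := frac_common_denominator (fun i : 'I_(size P) => P`_i).
pose P1 : {poly {poly F}} := \poly_(i < size P) oapp n 0 (insub i).
have P1E: map_poly (@FracField.tofrac _) P1 = tofrac b *: P.
  apply/polyP => i; rewrite coef_map coefZ coef_poly.
  case: ltnP => [ltiP | leP]; last by rewrite [LHS]raddf0 nth_default ?mulr0.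
  by rewrite insubT /= -bP.
exists (swapXY P1).
  rewrite swapXY_eq0; apply/negP => /eqP P10; move: P1E.
  rewrite P10 rmorph0 => /esym/eqP.
  by rewrite scaler_eq0 tofrac_eq0 (negPf b0) (negPf P0).
apply/rootP; rewrite horner_poly_at_swapXY.
rewrite -(eq_map_poly (poly_embedE K)) (map_poly_comp (GRing.in_alg K)) P1E.
have /rootP := root_minPoly 1%AS c.
by rewrite map_polyZ hornerZ cP => ->; rewrite mulr0.
Qed.

(** A form of the finiteness of [K] over F(c). Coordinates over a basis of [K]
    over F(t) turn vectors of [K]^I into vectors over F(t); multiplying them all
    by one common denominator, which does not affect relations over F[c], brings
    them into F[t], a subring of F[c][t]. *)
Lemma dependent_function_field (F : fieldType) (K : fieldExtType (ratfun F)) (c : K) :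
    ~ in_field_of_constants c ->
  exists M : nat, forall (I : finType) (N : nat) (x : 'I_N -> I -> K),
    (M * #|I| < N)%N -> lin_dependent (poly_at c) x.
Proof.
move=> ctr; have [Q Q0 Qt] := indeterminate_algebraic c.
exists (\dim {: K} * size Q)%N => I N x ltN.
pose n := \dim {: K}; pose e := vbasis {: K}.
have [b b0 [v bv]] := frac_common_denominator
  (fun il : 'I_N * I * 'I_n => coord e il.2 (x il.1.1 il.1.2)).
have [|u [u0 uv]] := @dependent_adjoin _ _ _ _ _ (I * 'I_n)%type N
    (fun i lk => map_poly polyC (v (i, lk.1, lk.2))) (poly_at_inj ctr) Q0 Qt.
  by rewrite card_prod card_ord -mulnA mulnC.
exists u; split=> // l.
have bK: poly_embed K b != 0 by rewrite fmorph_eq0 tofrac_eq0.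
apply: (mulfI bK); rewrite mulr0 mulr_sumr.
transitivity (\sum_i \sum_(k < n)
   poly_at c (u i) * poly_embed K (v (i, l, k)) * e`_k).
  apply: eq_bigr => i _; rewrite mulrCA.
  rewrite {1}(coord_vbasis (memvf (x i l))) !mulr_sumr; apply: eq_bigr => k _.
  rewrite -mulrA; congr (_ * _).
  rewrite [poly_embed K b]/= mulr_algl scalerA (bv (i, l, k)) /=.
  by rewrite mulr_algl.
rewrite exchange_big big1 // => k _; rewrite -mulr_suml.
rewrite [X in X * _](_ : _ = 0) ?mul0r // -[RHS](uv (l, k)).
by apply: eq_bigr => i _; rewrite (poly_embed_constE c).
Qed.

(** * Factors of Eisenstein polynomials over an extension *)

Definition reduce0 (F : fieldType) : {poly {poly F}} -> {poly F} :=
  map_poly (horner_eval 0).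

HB.instance Definition _ (F : fieldType) :=
  GRing.RMorphism.copy (@reduce0 F) (map_poly (horner_eval 0)).

Lemma reduce0_eq0 (F : fieldType) (p : {poly {poly F}}) :
  reduce0 p = 0 -> exists p', p = 'X *: p'.
Proof.
move=> /polyP p0; exists (\poly_(i < size p) (p`_i %/ 'X)).
apply/polyP => i; rewrite coefZ coef_poly.
case: ltnP => [ltip | leip]; last by rewrite nth_default ?mulr0.
rewrite mulrC divpK // -['X]subr0 dvdp_XsubCl; apply/rootP.
by have := p0 i; rewrite coef_map coef0.
Qed.

(** If [q] is prime to X then all of X^D divides [p]. *)
Lemma Xn_dvd_cofactor (F : fieldType) (D : nat) (a : F) (p q : {poly F}) :
  a != 0 -> a *: 'X^D = p * q -> q.[0] != 0 -> (D < size p)%N.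
Proof.
move=> a0 apq q0; have pq0: p * q != 0.
  by rewrite -apq scaler_eq0 negb_or a0 expf_neq0 ?polyX_eq0.
have p0: p != 0 by apply: contraNneq pq0 => ->; rewrite mul0r.
have Xp: 'X^D %| p.
  rewrite -(Gauss_dvdpl _ (_ : coprimep 'X^D q)) -?apq ?dvdpZr //.
  by rewrite coprimep_expl // coprimep_sym coprimepX.
by have := dvdp_leq p0 Xp; rewrite size_polyXn.
Qed.

(** Eisenstein's criterion at the prime X of F[X], for factorizations up to a
    nonzero scalar, i.e. factorizations over F(X). A factor X of [a] divides
    [q] or [h] and can be cancelled. Once [a] is prime to X, reduction at X = 0
    gives [reduce0 q * reduce0 h] proportional to 'X^D, and [q] and [h] cannot
    both have constant terms divisible by X, as X divides that of [P] only once.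
    So one of the reductions is prime to 'X and the other one takes the whole
    degree D. *)
Lemma eisenstein_pseudo (F : fieldType) (D : nat) (P q h : {poly {poly F}})
    (a : {poly F}) :
    size P = D.+1 -> reduce0 P = 'X^D -> P`_0`_1 != 0 ->
    a != 0 -> a *: P = q * h -> (1 < size h)%N -> (D < size h)%N.
Proof.
move=> szP redP P01.
have [n] := ubnP (size a); elim: n => // n IH in a q h *.
rewrite ltnS => sza a0 aP szh.
have h0: h != 0 by rewrite -size_poly_gt0 ltnW.
have aP0: a *: P != 0 by rewrite -size_poly_gt0 size_scale // szP.
have q0: q != 0 by apply: contraNneq aP0 => q0; rewrite aP q0 mul0r.
have redaP: a.[0] *: 'X^D = reduce0 q * reduce0 h.
  by rewrite -rmorphM /= -aP -redP /reduce0 map_polyZ.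
have [a00 | a00] := eqVneq a.[0] 0.
  (* X divides [a], so it divides [q] or [h] by primality *)
  have [|a' aE] := factor_theorem a 0 _; first exact/rootP.
  rewrite subr0 in aE.
  have a'0: a' != 0 by apply: contraNneq a0 => a'0; rewrite aE a'0 mul0r.
  have sza': (size a' < n)%N by move: sza; rewrite aE size_mulX.
  have XI : injective (fun p : {poly {poly F}} => 'X *: p).
    move=> p r /=; rewrite -!mul_polyC; apply: mulfI.
    by rewrite polyC_eq0 polyX_eq0.
  move: redaP; rewrite a00 scale0r => /esym/eqP; rewrite mulf_eq0.
  case/orP => /eqP/reduce0_eq0[p' pE].
    apply: (IH a' p' h) => //; apply: XI => /=.
    by rewrite scalerA mulrC -aE aP pE scalerAl.
  have szp': size h = size p' by rewrite pE size_scale ?polyX_eq0.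
  rewrite szp'; apply: (IH a' q p') => //; last by rewrite -szp'.
  by apply: XI; rewrite /= scalerA mulrC -aE aP pE scalerAr.
have red0 (p : {poly {poly F}}) : (reduce0 p).[0] = p`_0`_0.
  by rewrite horner_coef0 coef_map /= /horner_eval horner_coef0.
have P00: D != 0%N -> P`_0`_0 = 0.
  by move=> D0; rewrite -red0 redP hornerXn expr0n (negPf D0).
have [->|/P00 {}P00] := eqVneq D 0%N; first exact: ltnW.
have szred (p : {poly {poly F}}) : (size (reduce0 p) <= size p)%N by exact: size_poly.
have [h00|h00] := eqVneq (reduce0 h).[0] 0.
  rewrite mulrC in redaP; apply: (leq_trans _ (szred h)).
  apply: (Xn_dvd_cofactor a00 redaP).
  (* otherwise X^2 divides [q`_0 * h`_0], whose coefficient of X is that of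
     [a * P`_0], namely [a.[0] * P`_0`_1] *)
  apply/eqP => q00; move: P01.
  have: (a * P`_0)`_1 = (q`_0 * h`_0)`_1.
    by rewrite -(coefZ a P) aP coefM big_ord1.
  rewrite !coefM !big_ord_recl !big_ord0 /= P00 -!red0 q00 h00.
  rewrite !mulr0 mul0r !addr0.
  move/eqP; rewrite mulf_eq0 => /orP[|-> //].
  by rewrite -horner_coef0 (negPf a00).
have ltDq := leq_trans (Xn_dvd_cofactor a00 redaP h00) (szred q).
have := size_scale P a0; rewrite aP size_mul // szP => szqh.
by move: szh ltDq szqh; set m := size h; set k := size q; lia.
Qed.

(** An Eisenstein polynomial is, up to scalars, a minimal polynomial over F(X)
    of any of its roots: it is so also for the class of z modulo a factor [g]
    over [K]. A shorter [h] killing z would, by pseudo-division of [P], either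
    divide [P] or leave a shorter remainder that also kills z. *)
Lemma eisenstein_annihilator (F K : fieldType) (psi : {rmorphism {poly F} -> K})
    (D : nat) (P h : {poly {poly F}}) (g : {poly K}) :
    injective psi ->
    size P = D.+1 -> reduce0 P = 'X^D -> P`_0`_1 != 0 ->
    (1 < size g)%N -> g %| map_poly psi P ->
  h != 0 -> g %| map_poly psi h -> (D < size h)%N.
Proof.
move=> psi_inj szP redP P01 szg gP.
have [n] := ubnP (size h); elim: n => // n IH in h *.
rewrite ltnS => szhn h0 gh.
have szpsi p : size (map_poly psi p) = size p.
  by rewrite size_map_inj_poly ?rmorph0.
have szh: (1 < size h)%N.
  rewrite -szpsi (leq_trans szg) // dvdp_leq //.
  by rewrite -size_poly_gt0 szpsi size_poly_gt0.
have ltr: (size (P %% h)%R < size h)%N by rewrite ltn_modp.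
have divE := Pdiv.Idomain.divp_eq P h.
have [r0 | r0] := eqVneq (P %% h) 0.
  rewrite r0 addr0 in divE; apply: eisenstein_pseudo divE szh => //.
  by rewrite expf_neq0 // lead_coef_eq0.
apply: (ltn_trans _ ltr); apply: IH => //; first exact: leq_trans ltr szhn.
have : g %| map_poly psi (lead_coef h ^+ scalp P h *: P).
  by rewrite map_polyZ /= -mul_polyC dvdp_mull.
by rewrite divE rmorphD rmorphM dvdp_addr // dvdp_mull.
Qed.

(** The vectors are the powers of z below [D] in K[z]/(g), with coordinates
    indexed by the degrees below that of [g]; a relation between them would
    contradict [eisenstein_annihilator]. *)
Lemma eisenstein_factor_degree (F K : fieldType) (psi : {rmorphism {poly F} -> K})
    (M D : nat) (P : {poly {poly F}}) (g : {poly K}) :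
    injective psi ->
    (forall (I : finType) (N : nat) (x : 'I_N -> I -> K),
      (M * #|I| < N)%N -> lin_dependent psi x) ->
    size P = D.+1 -> reduce0 P = 'X^D -> P`_0`_1 != 0 ->
    (1 < size g)%N -> g %| map_poly psi P ->
  (D <= M * (size g).-1)%N.
Proof.
move=> psi_inj depM szP redP P01 szg gP; rewrite leqNgt; apply/negP => ltD.
have [|u [[i ui0] ug]] := @depM 'I_(size g).-1 D (fun i l => ('X^i %% g)`_l).
  by rewrite card_ord.
pose h : {poly {poly F}} := \poly_(i < D) oapp u 0 (insub i).
have hE (k : 'I_D) : h`_k = u k by rewrite coef_poly ltn_ord valK.
have g0: g != 0 by rewrite -size_poly_gt0 ltnW.
suff: (D < size h)%N by rewrite ltnNge size_poly.
apply: (eisenstein_annihilator psi_inj szP redP P01 szg gP).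
  by apply: contraNneq ui0 => h0; rewrite -hE h0 coef0.
have hE' : map_poly psi h = \sum_(k < D) psi (u k) *: 'X^k.
  rewrite /h poly_def rmorph_sum; apply: eq_bigr => k _.
  by rewrite [LHS]map_polyZ map_polyXn valK.
rewrite /dvdp hE' (big_morph (fun p : {poly K} => p %% g) (modpD g) (mod0p g)).
apply/eqP/polyP => l; rewrite coef0 coef_sum.
have [lts | les] := ltnP l (size g).-1; last first.
  apply: big1 => k _; rewrite nth_default //; apply: (leq_trans _ les).
  by rewrite -ltnS prednK ?size_poly_gt0 // ltn_modp.
rewrite -[RHS](ug (Ordinal lts)); apply: eq_bigr => k _.
by rewrite modpZl coefZ.
Qed.

(** * Iterates of z^d + a *)

Lemma poly_iterSr (R : comNzRingType) (f : {poly R}) n :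
  poly_iter f n.+1 = poly_iter f n \Po f.
Proof.
elim: n => [|n IH]; first by rewrite /poly_iter /= comp_polyXr comp_polyX.
by rewrite [LHS](_ : _ = f \Po poly_iter f n.+1) // [in LHS]IH comp_polyA.
Qed.

Lemma unicritical_iterS (R : comNzRingType) d (a : R) n :
  let f := 'X^d + a%:P in poly_iter f n.+1 = poly_iter f n ^+ d + a%:P.
Proof.
by rewrite /poly_iter iterS comp_polyD comp_polyC rmorphXn /= comp_polyX.
Qed.

Lemma size_unicritical_iter (R : idomainType) d (a : R) n :
  (0 < d)%N -> size (poly_iter ('X^d + a%:P) n) = (d ^ n).+1.
Proof.
move=> d0; set f := 'X^d + _.
suff szp: (size (poly_iter f n)).-1 = (d ^ n)%N.
  have: (0 < d ^ n)%N by rewrite expn_gt0 d0.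
  by rewrite -szp; case: (size _).
elim: n => [|n IH]; first by rewrite size_polyX.
by rewrite [poly_iter _ _]/= size_comp_poly IH size_XnaddC // expnS.
Qed.

Lemma map_poly_iter (R S : nzRingType) (psi : {rmorphism R -> S}) f n :
  map_poly psi (poly_iter f n) = poly_iter (map_poly psi f) n.
Proof.
elim: n => [|n IH]; first exact: map_polyX.
by rewrite [LHS](map_comp_poly psi f (poly_iter f n)) IH.
Qed.

Lemma reduce0_unicritical_iter (F : fieldType) d n :
  reduce0 (poly_iter ('X^d + ('X : {poly F})%:P) n) = 'X^(d ^ n).
Proof.
elim: n => [|n IH]; first exact: map_polyX.
rewrite unicritical_iterS rmorphD rmorphXn /= IH /reduce0 map_polyC /=.
by rewrite /horner_eval hornerX polyC0 addr0 -exprM mulnC -expnS.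
Qed.

(** The constant terms of the iterates satisfy w' = w^d + X, starting from 0, so
    each w is divisible by X and w^d by X^2: the linear coefficient of w' is 1.
    For [n = 0] the constant term vanishes. *)
Lemma coef1_unicritical_iter0 (F : fieldType) d n : (1 < d)%N -> (0 < n)%N ->
  (poly_iter ('X^d + ('X : {poly F})%:P) n)`_0`_1 != 0.
Proof.
case: n => // n d1 _.
set f := 'X^d + _.
have f00: (poly_iter f n)`_0`_0 = 0.
  have /polyP/(_ 0%N) := @reduce0_unicritical_iter F d n.
  rewrite coef_map /= /horner_eval horner_coef0 => ->.
  by rewrite coefXn eq_sym expn_eq0 eqn0Ngt (ltnW d1).
rewrite unicritical_iterS coefD coefC /= -horner_coef0 horner_exp horner_coef0.
rewrite coefD coefX /=.
move: (poly_iter f n)`_0 f00 => w w0; case: (d) d1 => [|[|e]] // _.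
rewrite !exprS !(coefM, big_ord_recl, big_ord0) /= w0.
rewrite !(mul0r, mulr0, addr0, add0r).
exact: oner_neq0.
Qed.

(** * Numbers of irreducible factors *)

Lemma irreducible_factorization (K : fieldType) (p : {poly K}) : (1 < size p)%N ->
  exists s : seq {poly K}, [/\ (0 < size s)%N,
    forall q, q \in s -> irreducible_poly q & p = \prod_(q <- s) q].
Proof.
have [n] := ubnP (size p); elim: n => // n IH in p *; rewrite ltnS => szpn szp.
have [irrp | redp] := classic (irreducible_poly p).
  by exists [:: p]; split=> [//|q|]; rewrite ?big_seq1 // inE => /eqP->.
have p0: p != 0 by rewrite -size_poly_gt0 ltnW.
have [q [szq /dvdpP[r pE] pq]] :
    exists q : {poly K}, [/\ size q != 1%N, q %| p & ~~ (q %= p)].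
  apply: NNPP => noq; apply: redp; split=> // q szq qp.
  by apply/negPn/negP => pq; apply: noq; exists q.
have [r0 q0] : r != 0 /\ q != 0.
  by apply/andP; rewrite -negb_or -mulf_eq0 -pE.
have szE := size_mul r0 q0; rewrite -pE in szE.
have szr: size r != 1%N.
  apply: contraNneq pq => /eqP/size_poly1P[k k0 rE].
  by rewrite pE rE mul_polyC eqp_sym eqp_scale.
have szr0 : (0 < size r)%N by rewrite size_poly_gt0.
have szq0 : (0 < size q)%N by rewrite size_poly_gt0.
have [szr1 [szq1 [szrn szqn]]] :
    (1 < size r)%N /\ (1 < size q)%N /\ (size r < n)%N /\ (size q < n)%N.
  move: szE szr szq szr0 szq0 szpn.
  by set m := size p; set k := size q; set l := size r; lia.
have [s [s0 irrs rs]] := IH r szrn szr1.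
have [t [t0 irrt qt]] := IH q szqn szq1.
exists (s ++ t); split; first by rewrite size_cat addn_gt0 s0.
  by move=> x; rewrite mem_cat => /orP[/irrs | /irrt].
by rewrite big_cat /= -rs -qt.
Qed.

Lemma size_prod_seq_pred (R : idomainType) (s : seq {poly R}) :
  \prod_(q <- s) q != 0 ->
  (size (\prod_(q <- s) q)).-1 = (\sum_(q <- s) (size q).-1)%N.
Proof.
elim: s => [|q s IH]; first by rewrite !big_nil size_poly1.
rewrite !big_cons mulf_eq0 negb_or => /andP[q0 s0].
rewrite size_mul // -IH //; move: q0 s0; rewrite -!size_poly_gt0.
by set m := size q; set k := size _; lia.
Qed.

(** Starting from some [t] attained at [n], either [t] persists for ever, or a
    strictly larger value is attained later; the latter happens at most [M]
    times. As [P] is only a relation, this applies to the lengths of all the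
    factorizations of an iterate at once. *)
Lemma bounded_nondecreasing_stable (P : nat -> nat -> Prop) (M : nat) :
    (exists t, P 1%N t) ->
    (forall n t, P n t -> exists2 t', (t <= t')%N & P n.+1 t') ->
    (forall n t, (0 < n)%N -> P n t -> (t <= M)%N) ->
  exists N t, forall n, (N < n)%N -> P n t.
Proof.
move=> [t1 P1] PS PM.
have Pge n k t : P n t -> exists2 t', (t <= t')%N & P (n + k)%N t'.
  move=> Pt; elim: k => [|k [t' tt' Pt']]; first by exists t; rewrite ?addn0.
  have [t'' t't'' Pt''] := PS _ _ Pt'.
  by exists t''; rewrite ?addnS // (leq_trans tt').
suff stab m n t : (0 < n)%N -> P n t -> (M - t < m)%N ->
    exists N t, forall n, (N < n)%N -> P n t.
  exact: (stab (M - t1).+1 1%N t1).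
elim: m n t => // m IH n t n0 Pt ltm.
have [Pall | /not_all_ex_not[k nPk]] := classic (forall k, P (n + k)%N t).
  by exists n, t => k /ltnW nk; rewrite -(subnKC nk).
have [t' tt' Pt'] := Pge n k t Pt.
have nk0 : (0 < n + k)%N by rewrite addn_gt0 n0.
have t'M := PM _ _ nk0 Pt'.
have ltt' : (t < t')%N.
  by rewrite ltn_neqAle tt' andbT; apply: contra_notN nPk => /eqP->.
by apply: (IH (n + k)%N t') => //; lia.
Qed.

(** Each [q \Po f] is nonconstant, hence has at least one irreducible factor. *)
Lemma irreducible_prod_comp (K : fieldType) (f : {poly K}) (s : seq {poly K}) :
    (1 < size f)%N -> (forall q, q \in s -> irreducible_poly q) ->
  exists s' : seq {poly K}, [/\ (size s <= size s')%N,
    forall q, q \in s' -> irreducible_poly q &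
    (\prod_(q <- s) q) \Po f = \prod_(q <- s') q].
Proof.
move=> szf; elim: s => [|q s IH] irrs.
  by exists [::]; split=> //; rewrite !big_nil comp_polyC.
have [|s1 [szs1 irr1 s1E]] := IH.
  by move=> x xs; apply: irrs; rewrite inE xs orbT.
have [|s2 [szs2 irr2 s2E]] := @irreducible_factorization K (q \Po f).
  have [szq _] := irrs q (mem_head _ _).
  have: (0 < (size (q \Po f)).-1)%N.
    by rewrite size_comp_poly muln_gt0 -!subn1 !subn_gt0 szq szf.
  by case: (size _) => [|[|l]].
exists (s2 ++ s1); split.
- by rewrite size_cat /= -add1n leq_add.
- by move=> x; rewrite mem_cat => /orP[/irr2 | /irr1].
by rewrite big_cons comp_polyM s1E s2E big_cat.
Qed.

Lemma product_of_irreduciblesP (K : fieldType) (t : nat) (p : {poly K}) :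
  product_of_irreducibles t p <->
  exists s : seq {poly K}, [/\ size s = t,
    forall q, q \in s -> irreducible_poly q & p = \prod_(q <- s) q].
Proof.
split=> [[s [irrs ->]] | [s [szs irrs ->]]].
  exists s; split; rewrite ?size_tuple ?big_tuple //.
  by move=> q /tnthP[i ->].
move/eqP: szs => szs; exists (Tuple szs); split.
  2: exact: (big_tuple _ _ (Tuple szs) xpredT id).
by move=> i; apply: irrs; apply: (mem_tnth i (Tuple szs)).
Qed.

(** * Eventual stability *)

Theorem corollary7 (F : fieldType) (K : fieldExtType (ratfun F)) (d : nat) (c : K)
    (hd : (2 <= d)%N)
    (hchar : forall p : nat, p \in [pchar K] -> ~~ (p %| d)%N)
    (hc : ~ in_field_of_constants c) :
  eventually_stable ('X^d + c%:P : {poly K}).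
Proof.
have d0 : (0 < d)%N := ltnW hd.
set f := 'X^d + _.
have szf : size f = d.+1 by rewrite size_XnaddC.
have [M depM] := dependent_function_field hc.
have fE : f = map_poly (poly_at c) ('X^d + ('X : {poly F})%:P).
  rewrite /f [RHS]rmorphD [X in _ = X + _]map_polyXn [X in _ = _ + X]map_polyC.
  congr (_ + _%:P).
  by rewrite [RHS]poly_atE map_polyX hornerX.
apply: (@bounded_nondecreasing_stable
  (fun n t => product_of_irreducibles t (poly_iter f n)) M).
- have [|s [_ irrs sE]] := @irreducible_factorization K (poly_iter f 1).
    by rewrite size_unicritical_iter // ltnS expn_gt0 d0.
  by exists (size s); apply/product_of_irreduciblesP; exists s.
- move=> n t /product_of_irreduciblesP[s [<- irrs sE]].
  have [|s' [les irrs' s'E]] := irreducible_prod_comp _ irrs (f := f).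
    by rewrite szf.
  exists (size s') => //; apply/product_of_irreduciblesP; exists s'; split => //.
  by rewrite poly_iterSr sE s'E.
move=> n t n0 /product_of_irreduciblesP[s [<- irrs sE]].
have szP : size (poly_iter ('X^d + ('X : {poly F})%:P) n) = (d ^ n).+1.
  exact: size_unicritical_iter.
have degq q : q \in s -> (d ^ n <= M * (size q).-1)%N.
  move=> qs; have [szq _] := irrs q qs.
  apply: (eisenstein_factor_degree (poly_at_inj hc) depM szP) => //.
  - exact: reduce0_unicritical_iter.
  - exact: coef1_unicritical_iter0.
  by rewrite map_poly_iter -fE sE (big_rem q) //= dvdp_mulr.
have := @size_prod_seq_pred K s; rewrite -sE size_unicritical_iter //=.
rewrite -size_poly_gt0 size_unicritical_iter // => /(_ isT) dnE.
have dn0 : (0 < d ^ n)%N by rewrite expn_gt0 d0.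
(* summing [degq] over the factors gives [size s * d ^ n <= M * d ^ n] *)
rewrite -(leq_pmul2r dn0) {2}dnE big_distrr /= -sum1_size big_distrl /=.
rewrite big_seq [leqRHS]big_seq; apply: leq_sum => q qs.
by rewrite mul1n degq.
Qed.
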